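(* In the CFL problem described in the context, given untrusted advice $\mathtt{ADV}$ and $\epsilon\in(0,\alpha-1]$, any $(1+\epsilon)$-consistent learning-augmented algorithm for CFL is at least $\gamma^\epsilon$-robust, where $\gamma^\epsilon$ is the unique positive solution of $$\gamma^\epsilon=\epsilon+\frac{U}{L}-\frac{\gamma^\epsilon}{L}(U-L)\ln\!\left(\frac{U-L-2\beta}{U-U/\gamma^\epsilon-2\beta}\right).$$
   Context: CFL setting. Fix $d\ge1$, $\mathbf{c}\in\mathbb{R}^d_{>0}$, $\mathbf{w}\in\mathbb{R}^d_{\ge0}$ and $0<L<U$. Write $\|\mathbf{x}\|_{\ell_1(\mathbf{v})}=\sum_i \mathbf{v}^i|\mathbf{x}^i|$. Constraint function $c(\mathbf{x})=\|\mathbf{x}\|_{\ell_1(\mathbf{c})}$; decision set $X=\{\mathbf{x}\in[0,1]^d: c(\mathbf{x})\le1\}$; $\beta:=\max_i\mathbf{w}^i/\mathbf{c}^i\in[0,(U-L)/2)$. An instance: horizon $T$ and convex $f_t:X\to\mathbb{R}$ with $f_t(\mathbf{0})=0$, $L\le[\nabla f_t]^i/\mathbf{c}^i\le U$. Online: $f_t$ revealed, then $\mathbf{x}_t\in X$ chosen irrevocably; $\mathbf{x}_0=\mathbf{x}_{T+1}=\mathbf{0}$; cost $\sum_{t=1}^Tf_t(\mathbf{x}_t)+\sum_{t=1}^{T+1}\|\mathbf{x}_t-\mathbf{x}_{t-1}\|_{\ell_1(\mathbf{w})}$; constraint $\sum_t c(\mathbf{x}_t)\ge1$. Utilization $z^{(t)}=\sum_{\tau\le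 t}c(\mathbf{x}_\tau)$; once $(T-(j+1))\mathbf{c}^i<1-z^{(j)}$ for all $i$, a compulsory trade makes maximal decisions to complete the constraint. $\mathtt{OPT}(\mathcal{I})$ is the offline optimum. $\alpha := [ W( (2\beta/U + L/U - 1) e^{2\beta/U-1} ) - 2\beta/U + 1 ]^{-1}$, $W$ the Lambert $W$ function. Advice: untrusted advice $\mathtt{ADV}=\{\mathbf{a}_t\in X:t\in[T]\}$ is a feasible solution revealed online ($\mathbf{a}_t$ together with $f_t$); $\mathtt{ADV}(\mathcal{I})$ is its total cost. A learning-augmented algorithm is $b$-consistent if its cost is at most $b\,\mathtt{ADV}(\mathcal{I})$ for all instances and advice, and $r$-robust if its cost is at most $r\,\mathtt{OPT}(\mathcal{I})$ for all instances and any advice.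
   Formalization: The equation can have two positive solutions (e.g. U=2, L=1, β=0, ε=1/4: about 1.34 and 3.49), so γ^ε is taken to be the unique solution in (0, U/L] for which the argument of the logarithm is positive. *)

(* Defs.v *)
From HB Require Import structures.
From mathcomp Require Import all_boot all_order all_algebra.
From mathcomp Require Import all_classical all_reals all_analysis.

Set Implicit Arguments.
Unset Strict Implicit.
Unset Printing Implicit Defensive.

Import Order.TTheory GRing.Theory Num.Theory.
Import numFieldNormedType.Exports.

Local Open Scope classical_set_scope.
Local Open Scope ring_scope.

Section CFL.
Context {R : realType} {d : nat}.
Implicit Types (x y v c w : 'rV[R]_d) (X : set 'rV[R]_d).

Definition wl1norm v x : R := \sum_i v 0 i * `|x 0 i|.

Definition decision_set c : set 'rV[R]_d :=
  [set x : 'rV[R]_d | (forall i, 0 <= x 0 i <= 1) /\ wl1norm c x <= 1].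

(* The default 0 of the maximum is harmless: it is used with 0 < d, w >= 0 and
   c > 0. *)
Definition switch_ratio c w : R := \big[Num.max/0]_i (w 0 i / c 0 i).

(* Costs are functions on X only, so differentiability is relative to X: y tends
   to x inside X. For X = decision_set c with c > 0 the interior of X is
   nonempty, so g is unique, also at boundary points. *)
Definition is_gradient_within X (f : 'rV[R]_d -> R) x (g : 'rV[R]_d) : Prop :=
  (f y - f x - \sum_i g 0 i * (y 0 i - x 0 i)) / `|y - x|
    @[y --> within X x^'] --> (0 : R).

Definition cost_function c (L U : R) (f : 'rV[R]_d -> R) : Prop :=
  [/\ convex_function (decision_set c) f,
      f 0 = 0 &
      forall x, decision_set c x -> exists g,
        is_gradient_within (decision_set c) f x g /\
        forall i, L <= g 0 i / c 0 i <= U].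

(* Time-indexed data are functions on nat of which only the values at
   1, ..., T matter. *)
Implicit Types (T t : nat) (f : nat -> 'rV[R]_d -> R) (s a : nat -> 'rV[R]_d).

Definition cfl_instance c (L U : R) T f : Prop :=
  forall t, (1 <= t <= T)%N -> cost_function c L U (f t).

Definition utilization c s t : R := \sum_(1 <= u < t.+1) wl1norm c (s u).

Definition feasible c T s : Prop :=
  (forall t, (1 <= t <= T)%N -> decision_set c (s t)) /\
  1 <= utilization c s T.

(* Forces x_0 = x_(T+1) = 0. *)
Definition padded T s t : 'rV[R]_d := if (1 <= t <= T)%N then s t else 0.

Definition total_cost w T f s : R :=
  \sum_(1 <= t < T.+1) f t (s t) +
  \sum_(1 <= t < T.+2) wl1norm w (padded T s t - padded T s t.-1).

Definition OPT c w T f : R :=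
  inf [set total_cost w T f s | s in [set s | feasible c T s]].

(* [A T h] is the decision taken at time [size h] after the history [h] of pairs
   (f_u, a_u), u = 1, ..., size h. The horizon is an argument because an
   algorithm needs it to tell when it must start completing the constraint;
   algorithms that use T only to trigger a compulsory trade are included. *)
Definition la_algorithm : Type :=
  nat -> seq (('rV[R]_d -> R) * 'rV[R]_d) -> 'rV[R]_d.

Implicit Type A : la_algorithm.

Definition run A T f a : nat -> 'rV[R]_d :=
  fun t => A T [seq (f u, a u) | u <- iota 1 t].

Definition cfl_algorithm c (L U : R) A : Prop :=
  forall T f a, cfl_instance c L U T f -> feasible c T a ->
    feasible c T (run A T f a).

Definition consistent c w (L U : R) A (b : R) : Prop :=
  forall T f a, cfl_instance c L U T f -> feasible c T a ->
    total_cost w T f (run A T f a) <= b * total_cost w T f a.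

Definition robust c w (L U : R) A (r : R) : Prop :=
  forall T f a, cfl_instance c L U T f -> feasible c T a ->
    total_cost w T f (run A T f a) <= r * OPT c w T f.

End CFL.

Section Constants.
Context {R : realType}.
Implicit Types (L U beta eps g : R).

(* Principal real branch W_0 on [-1/e, +oo[; 0 elsewhere. *)
Definition lambertW (z : R) : R :=
  xget 0 [set v : R | -1 <= v /\ v * expR v = z].

Definition alpha L U beta : R :=
  (lambertW ((2 * beta / U + L / U - 1) * expR (2 * beta / U - 1))
   - 2 * beta / U + 1)^-1.

(* The third condition says that the argument of ln is positive. The bound
   g <= U / L is needed for uniqueness: for small beta the equation has a second
   positive root above U / L (take U = 2, L = 1, beta = 0, eps = 1/4). *)
Definition gamma_solution L U beta eps g : Prop :=
  [/\ 0 < g, g <= U / L, 0 < U - U / g - 2 * beta &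
      g = eps + U / L
          - g / L * (U - L) * ln ((U - L - 2 * beta) / (U - U / g - 2 * beta))].

End Constants.

(* Main.v *)
Require Import Defs.
From HB Require Import structures.
From mathcomp Require Import all_boot all_order all_algebra.
From mathcomp Require Import all_classical all_reals all_analysis.
From mathcomp Require Import lra ring zify.

Import Order.TTheory GRing.Theory Num.Theory.
Import numFieldNormedType.Exports.
Local Open Scope ring_scope.

(** Let [k] attain the maximum [b = w^k / c^k]. An adversary uses linear costs
    whose price is [U] in every coordinate but [k], where it is chosen online.
    It lowers the price of [k] through levels [y] from [U / gamma] to [L]. At
    each level it repeats the price [y]; as soon as the algorithm buys a
    noticeable amount it shows [U] until the algorithm has switched back, so
    that every unit bought at [y] costs [y + 2 b]. When [m] consecutive rounds at
    price [y] have met no noticeable purchase, [OPT] is at most [y + 2 b / m] and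
    the adversary goes to the next level.

    If the game stops at level [y] and continues with [U], robustness forces the
    savings [S y], the sum of [(U - y' - 2 b) u(y')] over the levels [y' >= y], to
    be at least [U - r y]. If it continues with [L] and the advice, silent so
    far, buys everything there, consistency bounds the sum of
    [(y - L + 2 b) u(y)] by [eps L]. With the exchange rate
    [Phi y = (y - L + 2 b) / (U - y - 2 b)] between the two sums, Abel summation
    and a limit in the number of levels give, for [Y = U / gamma],
      [Phi Y (U - r Y) + r \int_L^Y Phi <= eps L].
    The equation for [gamma] says [gamma \int_L^Y Phi = eps L], and since [Phi] is
    nondecreasing the inequality fails for [r < gamma]. *)

(** * The exchange rate and the equation for gamma *)

Section Rates.
Context {R : realType} (L U b : R).
Implicit Types (x y eps g r : R).
Hypotheses (L_gt0 : 0 < L) (b_ge0 : 0 <= b) (LbU : L < U - 2 * b).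

Definition exchange_rate (y : R) : R := (y - L + 2 * b) / (U - y - 2 * b).

(** The closed form of [\int_L^y Phi]; the tangent inequality [rate_primitiveB] takes the place of
    integration. *)
Definition rate_primitive (y : R) : R :=
  L - y + (U - L) * ln ((U - L - 2 * b) / (U - y - 2 * b)).

Local Notation Phi := exchange_rate.
Local Notation K := rate_primitive.

Lemma exchange_rateE y : y < U - 2 * b ->
  Phi y = (U - L) / (U - y - 2 * b) - 1.
Proof. by move=> yU; rewrite /exchange_rate; field; lra. Qed.

Lemma exchange_rate_mono x y : x <= y -> y < U - 2 * b -> Phi x <= Phi y.
Proof.
move: (b_ge0) (LbU) => b0 LU xy yU; rewrite !exchange_rateE ?(le_lt_trans xy)// lerD2r.
by rewrite ler_pM2l ?lef_pV2 ?posrE; lra.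
Qed.

Lemma exchange_rate_ge0 y : L <= y -> y < U - 2 * b -> 0 <= Phi y.
Proof.
by move: (b_ge0) => b0 Ly yU; rewrite divr_ge0; lra.
Qed.

Lemma rate_primitive_L : K L = 0.
Proof.
move: (LbU) => LU.
by rewrite /rate_primitive divff ?ln1; lra.
Qed.

Lemma ln_ratio_le (x y : R) : 0 < x -> 0 < y -> ln (x / y) <= (x - y) / y.
Proof.
move=> x0 y0; have xy0 : 0 < x / y by rewrite divr_gt0.
have -> : x / y = 1 + (x - y) / y by field; lra.
by apply: le_ln1Dx; rewrite mulrBl divff ?gt_eqF//; lra.
Qed.

(** [K] is convex with derivative [Phi], and this is its tangent at [y], valid for [x] on either
    side. It comes from [ln t <= t - 1]. *)
Lemma rate_primitiveB x y : x < U - 2 * b -> y < U - 2 * b ->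
  K y - K x <= Phi y * (y - x).
Proof.
move: (b_ge0) (LbU) => b0 LU xU yU.
have a0 z : z < U - 2 * b -> 0 < U - z - 2 * b by lra.
have -> : K y - K x =
    (U - L) * ln ((U - x - 2 * b) / (U - y - 2 * b)) - (y - x).
  by rewrite /rate_primitive !ln_div ?posrE ?a0//; ring.
rewrite exchange_rateE// [leRHS]mulrBl mul1r lerD2r -mulrA ler_wpM2l; try lra.
rewrite (le_trans (ln_ratio_le _ _ _ _))// ?a0// mulrC ler_wpM2l//.
  by rewrite invr_ge0 ltW ?a0.
by lra.
Qed.

(** With [Y = U / g], multiplying the equation by [L] collects the logarithm into [K Y]; the bound
    [g <= U / L] turns into [L <= Y]. *)
Lemma gamma_solutionE eps g : gamma_solution L U b eps g <->
  [/\ 0 < g, L <= U / g < U - 2 * b & g * K (U / g) = eps * L].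
Proof.
move: (L_gt0) (b_ge0) (LbU) => L0 b0 LU.
split=> [[g0 gUL Yp gE]|[g0 /andP[LY YU] gK]].
  split=> //.
    by rewrite ler_pdivlMr// mulrC -ler_pdivlMr//= gUL/=; lra.
  rewrite /rate_primitive.
  move: gE; set l := ln _ => gE.
  have -> : g * (L - U / g + (U - L) * l) = g * L - U + L * (g / L * (U - L) * l).
    by field; lra.
  by rewrite {1}gE; field; lra.
split=> //; last 1 first.
- move: gK; rewrite /rate_primitive; set l := ln _ => gK.
  have {gK}E : eps = (g * L - U + g * (U - L) * l) / L.
    apply: (@mulIf _ L); rewrite ?gt_eqF// -gK; field; lra.
  by rewrite E; field; lra.
- by rewrite ler_pdivlMr// mulrC -ler_pdivlMr.
- by lra.
Qed.

(** Beyond [x] the slope of [K] is at least [Phi x], whereas [K x <= Phi x * (x - L) < Phi x * x];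
    hence [K x / x] increases strictly. *)
Lemma rate_primitive_div_mono x y : L <= x -> x < y -> y < U - 2 * b ->
  0 < Phi x -> K x * y < K y * x.
Proof.
move: (L_gt0) (b_ge0) (LbU) => L0 b0 LU Lx xy yU Px; have xU := lt_trans xy yU.
have Ky : Phi x * (y - x) <= K y - K x.
  by have := rate_primitiveB _ _ yU xU; lra.
have Kx : K x <= Phi x * (x - L).
  by have := rate_primitiveB _ _ LbU xU; rewrite rate_primitive_L subr0.
have -> : K y * x = (K y - K x) * x + K x * x by ring.
have : Phi x * (y - x) * x <= (K y - K x) * x by rewrite ler_wpM2r//; lra.
have : K x * (y - x) <= Phi x * (x - L) * (y - x) by rewrite ler_wpM2r//; lra.
have : 0 < Phi x * (y - x) * L.
  by apply: mulr_gt0 => //; apply: mulr_gt0 => //; lra.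
by lra.
Qed.

Lemma exchange_rate_gt0 y : L <= y -> y < U - 2 * b -> K y != 0 -> 0 < Phi y.
Proof.
move: (b_ge0) (LbU) => b0 LU Ly yU Ky0; rewrite divr_gt0//; last by lra.
rewrite lt_neqAle; apply/andP; split; last by lra.
apply: contra_neq Ky0 => /esym E.
by have -> : y = L by [lra]; exact: rate_primitive_L.
Qed.

(** In terms of [Y = U / g] the equation reads [K Y / Y = eps * L / U], whose left side is strictly
    monotone. *)
Lemma gamma_solution_unique eps g h : 0 < eps ->
  gamma_solution L U b eps g -> gamma_solution L U b eps h -> g = h.
Proof.
move: (L_gt0) (b_ge0) (LbU) => L0 b0 LU e0; have eL : 0 < eps * L by rewrite mulr_gt0.
wlog gh : g h / h <= g => [H sg sh|].
  by case/orP: (le_total h g) => /H => [/(_ sg sh)|/(_ sh sg) ->].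
move=> /gamma_solutionE[g0 /andP[Lg gU] Kg] /gamma_solutionE[h0 /andP[Lh hU] Kh].
apply/eqP; rewrite eq_le gh andbT leNgt; apply/negP => {}gh.
have U0 : 0 < U by lra.
have gne : g != 0 by lra.
have hne : h != 0 by lra.
have Kg0 : K (U / g) != 0.
  by apply: contraTneq eL => E; rewrite -Kg E mulr0 ltxx.
have gh' : U / g < U / h by rewrite ltr_pM2l// ltf_pV2 ?posrE.
have := rate_primitive_div_mono _ _ Lg gh' hU (exchange_rate_gt0 _ Lg gU Kg0).
have -> : K (U / g) = eps * L / g by rewrite -Kg; field.
have -> : K (U / h) = eps * L / h by rewrite -Kh; field.
have -> : eps * L / g * (U / h) = eps * L / h * (U / g).
  by field; rewrite gne hne.
by rewrite ltxx.
Qed.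

(* Along [U - y - 2 b = (U - L - 2 b) e^(-s)] the logarithm is [s], so that the
   intermediate value theorem applies to an explicit function of [s]. *)
Lemma gamma_solution_exists eps : 0 < eps -> exists g, gamma_solution L U b eps g.
Proof.
move: (L_gt0) (b_ge0) (LbU) => L0 b0 LU e0; have eL : 0 < eps * L by rewrite mulr_gt0.
have U0 : 0 < U by lra.
pose Y (s : R) := U - 2 * b - (U - L - 2 * b) * expR (- s).
(* This is [U * K (Y s) - eps * L * Y s]. The choice of [s1] makes [J s1] equal to
   [(U + eps * L) * (U - Y s1)]. *)
pose J (s : R) := U * (L - Y s + (U - L) * s) - eps * L * Y s.
pose s1 := 1 + eps * L / (U - L).
have s1_ge0 : 0 <= s1 by rewrite addr_ge0 ?divr_ge0//; lra.
have YU s : Y s < U - 2 * b.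
  have : 0 < (U - L - 2 * b) * expR (- s) by rewrite mulr_gt0 ?expR_gt0//; lra.
  by rewrite /Y; lra.
have YL s : 0 <= s -> L <= Y s.
  move=> s0; have : (U - L - 2 * b) * expR (- s) <= (U - L - 2 * b) * 1.
    by rewrite ler_wpM2l ?expR_le1 ?oppr_le0//; lra.
  by rewrite /Y; lra.
have J0 : J 0 <= 0.
  have -> : J 0 = - (eps * L * L).
    by rewrite /J /Y oppr0 expR0; ring.
  by rewrite oppr_le0 mulr_ge0//; lra.
have J1 : 0 <= J s1.
  have -> : J s1 = U * (U - Y s1) + eps * L * (U - Y s1).
    by rewrite /J /s1; field; lra.
  by rewrite addr_ge0// mulr_ge0//; have := YU s1; lra.
have cY : continuous Y.
  move=> s; apply: cvgB; first exact: cvg_cst.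
  apply: cvgM; first exact: cvg_cst.
  apply: (continuous_comp (f := -%R) (g := expR)); last exact: continuous_expR.
  exact: opp_continuous.
have cJ : continuous J.
  move=> s; apply: cvgB; last by apply: cvgM; [exact: cvg_cst|exact: cY].
  apply: cvgM; first exact: cvg_cst.
  apply: cvgD; first by apply: cvgB; [exact: cvg_cst|exact: cY].
  by apply: cvgM; [exact: cvg_cst|exact: cvg_id].
have [||s] := @IVT _ J 0 s1 0 s1_ge0.
- exact: continuous_subspaceT.
- by rewrite ge_min J0 le_max J1 orbT.
rewrite in_itv/= => /andP[s0 _] Js.
have Y0 : 0 < Y s by have := YL _ s0; lra.
exists (U / Y s); apply/gamma_solutionE.
have -> : U / (U / Y s) = Y s by field; lra.
split; first by rewrite divr_gt0.
  by rewrite YL// YU.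
rewrite /rate_primitive.
have -> : (U - L - 2 * b) / (U - Y s - 2 * b) = expR s.
  rewrite /Y expRN; field; rewrite gt_eqF ?expR_gt0//=; lra.
rewrite expRK; move: Js; rewrite /J => Js.
apply: (@mulIf _ (Y s)); first by lra.
rewrite mulrAC mulfVK; first by lra.
by lra.
Qed.

(** Since [eps * L = g * K Y] and [U = g * Y], the two sides differ by
    [(g - r) * (Phi Y * Y - K Y)], and [K Y <= Phi Y * (Y - L)]. *)
Lemma robustness_gap eps g r : 0 < eps -> gamma_solution L U b eps g -> r < g ->
  eps * L < Phi (U / g) * (U - r * (U / g)) + r * K (U / g).
Proof.
move: (L_gt0) (b_ge0) (LbU) => L0 b0 LU e0 /gamma_solutionE[g0 /andP[Lg gU] Kg] rg.
have eL : 0 < eps * L by rewrite mulr_gt0.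
have Kg0 : K (U / g) != 0.
  by apply: contraTneq eL => E; rewrite -Kg E mulr0 ltxx.
have P0 := exchange_rate_gt0 _ Lg gU Kg0.
have := rate_primitiveB _ _ LbU gU; rewrite rate_primitive_L subr0 => KP.
rewrite -Kg -subr_gt0; set P := Phi _ in P0 KP *; set Y := U / g in KP Lg *.
have gY : U = g * Y by rewrite /Y; field; lra.
have -> : P * (U - r * Y) + r * K Y - g * K Y = (g - r) * (P * Y - K Y).
  by rewrite gY; ring.
rewrite mulr_gt0 ?subr_gt0// (le_lt_trans KP)// ltr_pM2l//; lra.
Qed.

End Rates.

(** * The game against a decision rule *)

(** The ratio [1 + rho^-1] keeps the sum of all earlier thresholds below [rho] times the current
    one; the value 1 at [j = m] bounds the whole sum by [rho]. *)
Definition threshold {R : realType} (rho : R) (m j : nat) : R :=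
  (1 + rho^-1) ^+ j / (1 + rho^-1) ^+ m.

Section Game.
Context {R : realType} (v : seq R -> R).
Hypothesis v_ge0 : forall P, 0 <= v P.
Implicit Types (P Q : seq R) (p q y : R).

(* A history [P] lists the prices shown so far, most recent first, and [v P] is
   the amount bought in response to its head. *)
Fixpoint usage P : R := if P is p :: P' then usage P' + v P else 0.

Fixpoint weighted_usage q P : R :=
  if P is p :: P' then weighted_usage q P' + (p - q) * v P else 0.

Fixpoint variation P : R :=
  if P is p :: P' then variation P' + `|v P - v P'| else 0.

(** The extra [v P] is the final return to 0. *)
Definition round_trip P : R := variation P + v P.

Lemma usage_cat Q P : usage P <= usage (Q ++ P).
Proof. by elim: Q => //= p Q IH; rewrite (le_trans IH)// lerDl v_ge0. Qed.

Lemma variation_cat Q P :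
  variation P + `|v (Q ++ P) - v P| <= variation (Q ++ P).
Proof.
elim: Q => [|p Q IH] /=; first by rewrite subrr normr0 addr0.
have := ler_normD (v (p :: Q ++ P) - v (Q ++ P)) (v (Q ++ P) - v P).
by rewrite addrA subrK; lra.
Qed.

Lemma round_trip_cat Q P : round_trip P <= round_trip (Q ++ P).
Proof.
rewrite /round_trip; have := variation_cat Q P.
by have := ler_norm (v P - v (Q ++ P)); rewrite distrC; lra.
Qed.

Lemma weighted_usage_nseq q y n P :
  weighted_usage q (nseq n y ++ P) =
  weighted_usage q P + (y - q) * (usage (nseq n y ++ P) - usage P).
Proof. by elim: n => [|n IH] /=; [ring|rewrite IH; ring]. Qed.

Lemma usage_nseq_ge n y P e :
  (forall i, (i < n)%N -> e <= v (nseq i.+1 y ++ P)) ->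
  usage P + n%:R * e <= usage (nseq n y ++ P).
Proof.
elim: n => [|n IH] H /=; first by rewrite mul0r addr0.
have := IH (fun i ni => H i (ltnW ni)); have := H n (ltnSn n).
by rewrite -natr1 mulrDl mul1r /=; lra.
Qed.

Lemma usage_nseq_le n y P (c : nat -> R) :
  (forall i, (i < n)%N -> v (nseq i.+1 y ++ P) <= c i) ->
  usage (nseq n y ++ P) <= usage P + \sum_(i < n) c i.
Proof.
elim: n => [|n IH] H /=; first by rewrite big_ord0 addr0.
have := IH (fun i ni => H i (ltnW ni)); have := H n (ltnSn n).
by rewrite big_ord_recr /=; lra.
Qed.

Lemma first_exceed n y P (c : nat -> R) :
  (forall i, (i < n)%N -> v (nseq i.+1 y ++ P) <= c i) \/
  exists j, [/\ (j < n)%N, c j < v (nseq j.+1 y ++ P) &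
    forall i, (i < j)%N -> v (nseq i.+1 y ++ P) <= c i].
Proof.
elim: n => [|n [IH|[j [jn cj Hj]]]]; first by left.
- have [le|lt] := leP (v (nseq n.+1 y ++ P)) (c n).
    by left=> i; rewrite ltnS leq_eqVlt => /orP[/eqP->|/IH].
  by right; exists n; split.
- by right; exists j; split=> //; rewrite ltnS ltnW.
Qed.

(** * One price level of the game *)

Section Level.
Context (L U B rho : R) (m N T0 : nat).
Hypotheses (rho_gt0 : 0 < rho).
Local Notation thr := (threshold rho m).
Hypothesis N_large : B < N%:R * (rho * thr 0 / 2).
Hypothesis usage_bound : forall P, (size P <= T0)%N ->
  all (fun p => L <= p <= U) P -> usage P <= B.

Lemma threshold_gt0 j : 0 < thr j.
Proof.
have q0 : 0 < 1 + rho^-1 by rewrite addr_gt0// invr_gt0.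
by rewrite /threshold divr_gt0// exprn_gt0.
Qed.

(* The thresholds grow so fast that the usage collected below them is negligible
   compared with the first usage that exceeds one of them. *)
Lemma sum_threshold j : \sum_(i < j) thr i <= rho * thr j.
Proof.
elim: j => [|j IH]; first by rewrite big_ord0 mulr_ge0// ltW ?threshold_gt0.
have -> : rho * thr j.+1 = rho * thr j + thr j.
  rewrite /threshold exprS; field.
  by rewrite expf_neq0 ?gt_eqF ?addr_gt0 ?invr_gt0.
by rewrite big_ord_recr /= lerD2r.
Qed.

Lemma threshold_le j : thr 0 <= thr j.
Proof.
rewrite /threshold expr0 ler_wpM2r ?invr_ge0 ?exprn_ge0 ?exprn_ege1//.
- by rewrite addr_ge0// invr_ge0 ltW.
- by rewrite lerDl invr_ge0 ltW.
Qed.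

(** Otherwise [N] rounds at price [U], each with a purchase above the bound, would push the usage
    beyond [B]. *)
Lemma up_run P : L <= U -> all (fun p => L <= p <= U) P ->
  (size P + N <= T0)%N ->
  exists2 l, (l <= N)%N & v (nseq l U ++ P) <= rho * thr 0 / 2.
Proof.
move=> LU PLU PT; apply: contrapT => H.
have : usage (nseq N U ++ P) <= B.
  apply: usage_bound; first by rewrite size_cat size_nseq addnC.
  by rewrite all_cat PLU all_nseq LU lexx orbT.
apply/negP; rewrite -ltNge (lt_le_trans N_large)//.
have : usage P + N%:R * (rho * thr 0 / 2) <= usage (nseq N U ++ P).
  apply: usage_nseq_ge => i iN; rewrite leNgt; apply/negP => lt.
  by apply: H; exists i.+1 => //; exact: ltW.
by apply: le_trans; rewrite lerDr; elim: (P) => //= p Q IH; rewrite addr_ge0.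
Qed.

(** An attempt shows [U] until little is held, then [y] until round [i] exceeds [thr i]. A failed
    attempt adds at least [thr 0] to the usage, so fewer than [k] more can follow; [u] is the total
    bought at [y]. *)
Lemma level_play y k P : L <= y <= U ->
  all (fun p => L <= p <= U) P -> (size P + k * (N + m) <= T0)%N ->
  B < usage P + k%:R * thr 0 ->
  exists Q (u : R), let P' := nseq m y ++ Q ++ P in
    [/\ (size P' <= size P + k * (N + m))%N,
        all (fun p => L <= p <= U) P', 0 <= u & usage P + u <= usage P'] /\
    [/\ weighted_usage U P' = weighted_usage U P - (U - y) * u,
        weighted_usage L P + (y - L) * u <= weighted_usage L P' &
        round_trip P + (2 - 3 * rho) * u - 2 * rho <= round_trip P'].
Proof.
move: (rho_gt0) => r0 yLU; have LU : L <= U by lra.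
elim: k P => [|k IH] P PLU PT Bu.
  move: Bu; rewrite mul0r addr0 ltNge usage_bound//.
  by rewrite (leq_trans _ PT)// leq_addr.
have [l lN vl] : exists2 l, (l <= N)%N & v (nseq l U ++ P) <= rho * thr 0 / 2.
  by apply: up_run => //; move: PT; rewrite mulSn; clear; lia.
set P1 := nseq l U ++ P in vl.
have P1LU : all (fun p => L <= p <= U) P1.
  by rewrite all_cat PLU all_nseq LU lexx orbT.
have sP1 : size P1 = (l + size P)%N by rewrite size_cat size_nseq.
have rt1 := round_trip_cat (nseq l U) P.
have us1 := usage_cat (nseq l U) P.
have wU1 := weighted_usage_nseq U U l P.
have wL1 := weighted_usage_nseq L U l P.
rewrite -/P1 subrr mul0r addr0 in rt1 us1 wU1 wL1.
have {}wL1 : weighted_usage L P <= weighted_usage L P1.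
  by rewrite wL1 lerDl mulr_ge0 ?subr_ge0.
have allyn j : all (fun p => L <= p <= U) (nseq j y ++ P1).
  by rewrite all_cat P1LU all_nseq yLU orbT.
have [small|[j [jm big small]]] := first_exceed m y P1 thr.
(* A successful attempt: [u <= rho], so the claimed increase of [round_trip] is not positive. *)
- have us := usage_nseq_le _ _ _ _ small.
  have thrm : thr m = 1.
    by rewrite /threshold divff// expf_neq0// gt_eqF// addr_gt0// invr_gt0.
  have := sum_threshold m; rewrite thrm mulr1 => sm.
  have us' := usage_cat (nseq m y) P1.
  have rt := round_trip_cat (nseq m y) P1.
  exists (nseq l U), (usage (nseq m y ++ P1) - usage P1); rewrite -/P1.
  set u := usage _ - usage P1.
  have u0 : 0 <= u by rewrite subr_ge0.
  have ur : u <= rho by rewrite /u; lra.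
  split; split=> //.
  + by move: lN; rewrite size_cat size_nseq sP1 mulSn; clear; lia.
  + by rewrite /u; lra.
  + by rewrite weighted_usage_nseq -/u; lra.
  + by rewrite weighted_usage_nseq -/u; lra.
  + have : 0 <= rho * u by rewrite mulr_ge0// ltW.
    lra.
- set P2 := nseq j.+1 y ++ P1; set u := usage P2 - usage P1.
  have us := usage_nseq_le _ _ _ _ small.
  have uE : u = usage (nseq j y ++ P1) + v P2 - usage P1 by [].
  have uE' : u = usage P2 - usage P1 by [].
  have usj := usage_cat (nseq j y) P1.
  have sj := sum_threshold j; have tj := threshold_le j; have t0 := threshold_gt0 0.
  have vu : v P2 <= u by lra.
  have uv : u <= v P2 + rho * v P2.
    by have : rho * thr j <= rho * v P2 by [apply: ler_wpM2l; lra]; lra.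
  (* Of the loss [3 * rho * u], two thirds stem from purchases before the exceeding one, one third
     from the holding [v P1] left after the prices [U]. *)
  have rt : round_trip P1 + (2 - 3 * rho) * u <= round_trip P2.
    have := variation_cat (nseq j.+1 y) P1; rewrite -/P2 /round_trip.
    have := ler_norm (v P2 - v P1).
    have : rho * thr 0 <= rho * u by apply: ler_wpM2l; lra.
    have : rho * v P2 <= rho * u by apply: ler_wpM2l; lra.
    lra.
  have kE : k.+1%:R * thr 0 = k%:R * thr 0 + thr 0 :> R.
    by rewrite -natr1 mulrDl mul1r.
  have sP2 : size P2 = (j.+1 + l + size P)%N by rewrite size_cat size_nseq sP1 addnA.
  have [||Q [u' [[sz al u'0 us2] [wU wL rt2]]]] := IH P2 (allyn _).
  + by move: lN jm PT; rewrite sP2 mulSn; clear; lia.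
  + by move: Bu; rewrite kE; lra.
  have wU2 := weighted_usage_nseq U y j.+1 P1.
  have wL2 := weighted_usage_nseq L y j.+1 P1.
  rewrite -/P2 -/u in wU2 wL2.
  exists (Q ++ nseq j.+1 y ++ nseq l U), (u + u').
  rewrite -!catA -/P1 -/P2.
  move: sz al us2 wU wL rt2; set P3 := nseq m y ++ _ => sz al us2 wU wL rt2.
  split; split=> //.
  + by apply: leq_trans sz _; move: lN jm; rewrite sP2 mulSn; clear; lia.
  + by rewrite addr_ge0//; lra.
  + by lra.
  + by rewrite wU; lra.
  + by lra.
  + by lra.
Qed.

End Level.
End Game.

(* If all the prices after [P] equal [q], the total cost is at least
   [q + excess_cost v b q P]. *)
Definition excess_cost {R : realType} (v : seq R -> R) (b q : R) (P : seq R) : R :=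
  weighted_usage v q P + b * round_trip v P.

Lemma excess_cost_ge0 {R : realType} (v : seq R -> R) (b q : R) (P : seq R) :
  (forall P', 0 <= v P') -> 0 <= b -> all (fun p => q <= p) P ->
  0 <= excess_cost v b q P.
Proof.
move=> v0 b0 qP; apply: addr_ge0.
  elim: P qP => //= p P IH /andP[qp /IH wP].
  by rewrite addr_ge0// mulr_ge0// subr_ge0.
apply: mulr_ge0 => //; apply: addr_ge0 => //.
by elim: P {qP} => //= p P IH; rewrite addr_ge0.
Qed.

(* Every unit bought at price [y] also pays [2 b] of switching, so one unit of
   savings against the price [U] costs [exchange_rate L U b y] against [L]. *)
Lemma exchange_step {R : realType} (L U b rho Y y u t WL WU s : R) :
  0 <= b -> 0 < rho -> L <= y -> y <= Y -> Y < U - 2 * b ->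
  0 <= u -> u <= s -> (y - L) * u <= WL -> WU = - ((U - y) * u) ->
  (2 - 3 * rho) * u - 2 * rho <= t ->
  - exchange_rate L U b y * (WU + b * t)
    - b * (1 + exchange_rate L U b Y) * rho * (3 * s + 2) <= WL + b * t.
Proof.
move=> b0 r0 Ly yY YU u0 us HL -> ht.
have P0 : 0 <= exchange_rate L U b y by rewrite divr_ge0; lra.
have PY : exchange_rate L U b y <= exchange_rate L U b Y.
  by apply: exchange_rate_mono; lra.
have E : exchange_rate L U b y * (U - y - 2 * b) = y - L + 2 * b.
  by rewrite mulfVK; lra.
move: P0 PY E; set p := exchange_rate L U b y; set pY := exchange_rate L U b Y.
move=> P0 PY E.
(* For [t = 2 * u] the trade balances exactly. The shortfall [rho * (3 * u + 2)] weighs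
   [b * (1 + p)], since switching enters both sides. *)
have Eu : p * (U - y) * u = (y - L) * u + 2 * b * (1 + p) * u.
  have -> : p * (U - y) = y - L + 2 * b + 2 * b * p by rewrite -E; ring.
  by ring.
have bp0 : 0 <= b * (1 + p) by rewrite mulr_ge0//; lra.
have ht' : b * (1 + p) * ((2 - 3 * rho) * u - 2 * rho) <= b * (1 + p) * t.
  by rewrite ler_wpM2l.
have H1 : b * (1 + p) * rho * (3 * u + 2) <= b * (1 + pY) * rho * (3 * s + 2).
  apply: ler_pM; [by apply: mulr_ge0 => //; lra|by lra| |by lra].
  by apply: ler_wpM2r; [lra|apply: ler_wpM2l; lra].
have -> : - p * (- ((U - y) * u) + b * t) = p * (U - y) * u - p * b * t by ring.
have : b * (1 + p) * t = b * t + p * b * t by ring.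
have : b * (1 + p) * ((2 - 3 * rho) * u - 2 * rho) =
   2 * b * (1 + p) * u - b * (1 + p) * rho * (3 * u + 2) by ring.
by lra.
Qed.

(** * The descent through all price levels *)

Section Adversary.
Context {R : realType} (v : seq R -> R) (L U b B rho r delta Y : R).
Context (m N k n : nat).
Hypotheses (v_ge0 : forall P, 0 <= v P) (rho_gt0 : 0 < rho) (b_ge0 : 0 <= b).
Hypotheses (r_ge0 : 0 <= r) (LY : L <= Y) (YU : Y < U - 2 * b) (n_gt0 : (0 < n)%N).
Implicit Types (P : seq R).
Local Notation T0 := (n.+1 * (k * (N + m)))%N.
Local Notation Phi := (exchange_rate L U b).
Local Notation K := (rate_primitive L U b).
Local Notation Psi := (excess_cost v b).
Local Notation h := ((Y - L) / n%:R).
Local Notation level j := (Y - j%:R * ((Y - L) / n%:R)).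
Local Notation kappa := (b * (1 + Phi Y) * rho).
Local Notation in_range := (all (fun p => L <= p <= U)).
Hypothesis N_large : B < N%:R * (rho * threshold rho m 0 / 2).
Hypothesis k_large : B < k%:R * threshold rho m 0.
Hypothesis usage_bound :
  forall P, (size P <= T0)%N -> in_range P -> usage v P <= B.
Hypothesis robust_bound : forall P y, L <= y <= U ->
  (size (nseq m y ++ P) <= T0)%N -> in_range (nseq m y ++ P) ->
  U + Psi U (nseq m y ++ P) <= r * (y + delta).

Lemma usage_ge0 P : 0 <= usage v P.
Proof. by elim: P => //= p Q IH; rewrite addr_ge0. Qed.

(** The error is expressed by the increment of usage, so that it telescopes over the levels. *)
Lemma level_exchange y P : L <= y <= Y -> in_range P ->
  (size P + k * (N + m) <= T0)%N ->
  exists Q, let P' := nseq m y ++ Q in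
  [/\ (size P' <= size P + k * (N + m))%N, in_range P' &
      Phi y * (Psi U P - Psi U P')
        - kappa * (3 * (usage v P' - usage v P) + 2) <= Psi L P' - Psi L P].
Proof.
move: (b_ge0) (YU) => b0 YU' /andP[Ly yY] PLU PT.
have yLU : L <= y <= U by lra.
have Bk : B < usage v P + k%:R * threshold rho m 0.
  by rewrite (lt_le_trans k_large)// lerDr usage_ge0.
have [Q [u [[sz al u0 us] [wU wL rt]]]] :=
  level_play v v_ge0 L U B rho m N T0 rho_gt0 N_large usage_bound
    y k P yLU PLU PT Bk.
exists (Q ++ P); move: sz al us wU wL rt; set P' := nseq m y ++ _.
move=> sz al us wU wL rt; split=> //.
have := exchange_step L U b rho Y y u
  (round_trip v P' - round_trip v P)
  (weighted_usage v L P' - weighted_usage v L P)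
  (weighted_usage v U P' - weighted_usage v U P)
  (usage v P' - usage v P) b0 rho_gt0 Ly yY YU u0.
have -> : Psi U P - Psi U P' = - (weighted_usage v U P' - weighted_usage v U P
    + b * (round_trip v P' - round_trip v P)) by rewrite /excess_cost; ring.
have -> : Psi L P' - Psi L P = weighted_usage v L P' - weighted_usage v L P
    + b * (round_trip v P' - round_trip v P) by rewrite /excess_cost; ring.
by rewrite mulrN mulNr; apply; lra.
Qed.

(* A discrete integration by parts: [K Y - K (level j)] is the integral of [Phi]
   over the levels passed so far, and the terms in [h], [delta] and [kappa] are
   the errors of discretisation, of [OPT] and of the switching costs. *)
Lemma level_chain j : (j <= n)%N ->
  exists P, let P' := nseq m (level j) ++ P in
  [/\ (size P' <= j.+1 * (k * (N + m)))%N, in_range P' &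
      Phi (level j) * (- Psi U P' - (U - r * level j)) + Phi Y * (U - r * Y)
      + r * (K Y - K (level j)) - r * h * (Phi Y - Phi (level j))
      - r * delta * (Phi Y - Phi (level j))
      - kappa * (3 * usage v P' + 2 * j.+1%:R) <= Psi L P'].
Proof.
move: (b_ge0) (YU) (LY) => b0 YU' LY'.
have h0 : 0 <= h by rewrite divr_ge0//; lra.
have hn : n%:R * h = Y - L by field; rewrite pnatr_eq0 -lt0n.
have lev i : (i <= n)%N -> L <= level i <= Y.
  move=> ni; apply/andP; split; last by rewrite gerBl mulr_ge0.
  have : i%:R * h <= n%:R * h by rewrite ler_wpM2r// ler_nat.
  lra.
have szle i : (i <= n)%N -> (i.+1 * (k * (N + m)) <= T0)%N.
  by move=> ni; rewrite leq_mul2r ltnS ni orbT.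
elim: j => [_|j IH jn].
  have [|||Q [sz al ex]] := level_exchange Y [::].
  - by rewrite LY lexx.
  - by [].
  - by rewrite add0n -[leqLHS]mul1n leq_mul2r orbT.
  exists Q; rewrite mul0r subr0 mul1n; split=> //.
  have b0v : 0 <= b * v [::] by rewrite mulr_ge0.
  have : 0 <= Phi Y * (b * v [::]) by rewrite mulr_ge0// exchange_rate_ge0.
  have nilE q : Psi q [::] = b * v [::].
    by rewrite /excess_cost /round_trip /= !add0r.
  by move: ex; rewrite !nilE /=; lra.
have {IH}[P] := IH (ltnW jn).
have := lev _ (ltnW jn); have := lev _ jn.
have -> : level j.+1 = level j - h by rewrite -natr1; ring.
set y := level j; set y' := y - h => y'r yr [sz al inv].
have [|Q [sz' al' ex]] := level_exchange y' _ y'r al.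
  by rewrite (leq_trans _ (szle _ jn))// mulSn addnC leq_add2l.
exists Q; move: sz' al' ex; set P' := nseq m y' ++ Q => sz' al' ex.
split=> //.
  by rewrite (leq_trans sz')// mulSn addnC leq_add2l.
have rob : U + Psi U (nseq m y ++ P) <= r * (y + delta).
  by apply: robust_bound => //; [lra|rewrite (leq_trans sz)// szle// ltnW].
move: rob inv ex; set P0 := nseq m y ++ P => rob inv ex.
have mono : Phi y' <= Phi y by apply: exchange_rate_mono; rewrite /y'; lra.
(* A rectangle of height [Phi y] covers the integral; the correction [r * h * (Phi y - Phi y')]
   lowers it to height [Phi y'] and telescopes. *)
have cvx : K y - K y' <= Phi y * h.
  have -> : h = y - y' by rewrite /y'; ring.
  by apply: rate_primitiveB; lra.
have : r * (K y - K y') <= r * (Phi y * h) by rewrite ler_wpM2l.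
(* Summation by parts: robustness at the level just completed is weighted by the drop of the
   rate. *)
have : (Phi y - Phi y') * (U + Psi U P0) <= (Phi y - Phi y') * (r * (y + delta)).
  by rewrite ler_wpM2l// subr_ge0.
rewrite -[j.+2%:R]natr1.
by rewrite /y' in ex *; lra.
Qed.
(** The last level is [L], where [K] vanishes and robustness makes the savings term at least
    [- r * delta * Phi L]; consistency enters as [e]. *)
Lemma adversary_value e :
  (forall P, (size P <= T0)%N -> in_range P -> Psi L P <= e) ->
  Phi Y * (U - r * Y) + r * K Y <=
  e + r * Phi Y * (delta + h) + kappa * (3 * B + 2 * n.+1%:R).
Proof.
move: (b_ge0) (YU) (LY) (rho_gt0) => b0 YU' LY' rho0 bound.
have h0 : 0 <= h by rewrite divr_ge0//; lra.
have hn : level n = L by field; rewrite pnatr_eq0 -lt0n.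
have [P] := level_chain n (leqnn _); rewrite hn => -[sz al].
have rob : U + Psi U (nseq m L ++ P) <= r * (L + delta).
  by apply: robust_bound => //; lra.
have := bound _ sz al; have := usage_bound _ sz al.
move: rob; set P' := nseq m L ++ P => rob us bd.
have PL : 0 <= Phi L by rewrite exchange_rate_ge0//; lra.
have PY : 0 <= Phi Y by rewrite exchange_rate_ge0//; lra.
rewrite rate_primitive_L; last by lra.
have : Phi L * (U + Psi U P') <= Phi L * (r * (L + delta)) by rewrite ler_wpM2l.
have : 0 <= r * h * Phi L by apply: mulr_ge0 => //; apply: mulr_ge0.
have : kappa * usage v P' <= kappa * B.
  by apply: ler_wpM2l => //; apply: mulr_ge0; [apply: mulr_ge0; lra|lra].
by lra.
Qed.

End Adversary.

Lemma natr_mul_unbounded {R : realType} (x e : R) :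
  0 < e -> exists n : nat, x < n%:R * e.
Proof.
move=> e0; have [x0|x0] := leP 0 x; last by exists 0; rewrite mul0r.
exists (Num.bound (x / e)); rewrite -ltr_pdivrMr//.
by apply: archi_boundP; rewrite divr_ge0// ltW.
Qed.

(** Each of three errors takes at most a quarter of the gap. First [n] and [m] are chosen, then
    [rho] from [n], then [N] and [k] from [m] and [rho]; all precede [v], so [T0] can enter the
    horizon given to the algorithm. *)
Lemma adversary_wins {R : realType} (L U b B eps r Y : R) (m0 : nat) :
  0 <= b -> 0 <= r -> 0 <= eps -> 0 <= B -> L <= Y -> Y < U - 2 * b ->
  eps * L < exchange_rate L U b Y * (U - r * Y) + r * rate_primitive L U b Y ->
  exists m T0 : nat, [/\ (m0 <= m)%N, (0 < m)%N & forall v : seq R -> R,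
    (forall P, 0 <= v P) ->
    (forall P, (size P <= T0)%N -> all (fun p => L <= p <= U) P ->
      usage v P <= B) ->
    (forall P, (size P <= T0)%N -> all (fun p => L <= p <= U) P ->
      L + excess_cost v b L P <= (1 + eps) * (L + 2 * b / m%:R)) ->
    ~ (forall P y, L <= y <= U -> (size (nseq m y ++ P) <= T0)%N ->
      all (fun p => L <= p <= U) (nseq m y ++ P) ->
      U + excess_cost v b U (nseq m y ++ P) <= r * (y + 2 * b / m%:R))].
Proof.
move=> b0 r0 e0 B0 LY YU.
have PY : 0 <= exchange_rate L U b Y by rewrite exchange_rate_ge0.
set Phi := exchange_rate L U b Y in PY *; rewrite -subr_gt0; set g := _ - _ => g0.
have rP0 : 0 <= r * Phi by rewrite mulr_ge0.
have [n1 hn1] := natr_mul_unbounded (r * Phi * (Y - L)) (g / 4)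
  (divr_gt0 g0 (ltr0n _ 4)).
(* The term [2 * b / m%:R] occurs with factor [1 + eps] in the consistency bound and with factor
   [r * Phi] as [delta]. *)
have [m1 hm1] := natr_mul_unbounded ((1 + eps + r * Phi) * (2 * b)) (g / 4)
  (divr_gt0 g0 (ltr0n _ 4)).
pose n := n1.+1; pose m := (m0 + m1).+1.
have n_gt0 : 0 < n%:R :> R by rewrite ltr0n.
have m_gt0 : 0 < m%:R :> R by rewrite ltr0n.
have hn : r * Phi * ((Y - L) / n%:R) < g / 4.
  rewrite mulrA ltr_pdivrMr//; apply: (lt_le_trans hn1).
  by rewrite mulrC; apply: ler_wpM2l; [lra|rewrite ler_nat].
have hm : (1 + eps + r * Phi) * (2 * b / m%:R) < g / 4.
  rewrite mulrA ltr_pdivrMr//; apply: (lt_le_trans hm1).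
  by rewrite mulrC; apply: ler_wpM2l; [lra|rewrite ler_nat leqW ?leq_addl].
pose D := b * (1 + Phi) * (3 * B + 2 * n.+1%:R) + 1.
have D1 : 1 <= D.
  by rewrite lerDr !mulr_ge0// ?addr_ge0// mulr_ge0.
pose rho := g / 4 / D.
have rho0 : 0 < rho by rewrite !divr_gt0//; lra.
have hrho : b * (1 + Phi) * rho * (3 * B + 2 * n.+1%:R) <= g / 4.
  have -> : b * (1 + Phi) * rho * (3 * B + 2 * n.+1%:R) = rho * (D - 1).
    by rewrite /D; ring.
  have -> : g / 4 = rho * D by rewrite /rho; field; lra.
  by rewrite ler_wpM2l//; lra.
have t0 := threshold_gt0 rho m rho0 0.
have [N hN] := natr_mul_unbounded B (rho * threshold rho m 0 / 2)
  (divr_gt0 (mulr_gt0 rho0 t0) (ltr0n _ 2)).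
have [k hk] := natr_mul_unbounded B (threshold rho m 0) t0.
exists m, (n.+1 * (k * (N + m)))%N; split=> //.
  by rewrite /m -addnS leq_addr.
move=> v v0 us cons rob.
have := adversary_value v L U b B rho r (2 * b / m%:R) Y m N k n
  v0 rho0 b0 r0 LY YU (ltn0Sn _) hN hk us rob
  (eps * L + (1 + eps) * (2 * b / m%:R)).
suff /[swap]/[apply] : forall P, (size P <= n.+1 * (k * (N + m)))%N ->
    all (fun p => L <= p <= U) P ->
    excess_cost v b L P <= eps * L + (1 + eps) * (2 * b / m%:R).
  by rewrite -/Phi; move: g0 hn hm hrho; rewrite /g; lra.
by move=> P sz al; have := cons P sz al; lra.
Qed.

(** * Linear instances of CFL *)

Section HistorySums.
Context {R : realType} (v : seq R -> R) (X price : nat -> R).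
Implicit Types (P Q : seq R).

(** Suffixes of [P] are the earlier states of the play, hence the agreement of [v] with [X] on all
    of them. *)
Lemma usage_sum P :
  (forall Q P', P = Q ++ P' -> v P' = X (size P')) ->
  usage v P = \sum_(1 <= t < (size P).+1) X t.
Proof.
elim: P => [|p P IH] vX; first by rewrite big_geq.
rewrite big_nat_recr//= -(vX [::] (p :: P))// IH// => Q P' PE.
by apply: (vX (p :: Q)); rewrite PE.
Qed.

Lemma weighted_usage_sum q P :
  (forall Q P', P = Q ++ P' -> v P' = X (size P')) ->
  (forall Q p P', P = Q ++ p :: P' -> p = price (size P').+1) ->
  weighted_usage v q P = \sum_(1 <= t < (size P).+1) (price t - q) * X t.
Proof.
elim: P => [|p P IH] vX pE; first by rewrite big_geq.
rewrite big_nat_recr//= -(vX [::] (p :: P))// -(pE [::] p P)// IH//.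
  by move=> Q P' PE; apply: (vX (p :: Q)); rewrite PE.
by move=> Q p' P' PE; apply: (pE (p :: Q)); rewrite PE.
Qed.

Lemma variation_sum P :
  (forall Q P', P = Q ++ P' -> v P' = X (size P')) ->
  variation v P = \sum_(1 <= t < (size P).+1) `|X t - X t.-1|.
Proof.
elim: P => [|p P IH] vX; first by rewrite big_geq.
rewrite big_nat_recr//= -(vX [::] (p :: P))// -(vX [:: p] P)// IH// => Q P' PE.
by apply: (vX (p :: Q)); rewrite PE.
Qed.

End HistorySums.

Lemma ler_norm_telescope {R : realType} (X : nat -> R) (l n : nat) : (l <= n)%N ->
  `|X n - X l| <= \sum_(l.+1 <= t < n.+1) `|X t - X t.-1|.
Proof.
elim: n => [|n IH]; first by rewrite leqn0 => /eqP ->; rewrite subrr normr0 big_geq.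
rewrite leq_eqVlt => /orP[/eqP->|]; first by rewrite subrr normr0 big_geq.
rewrite ltnS => ln; rewrite big_nat_recr//=.
by have := ler_distD (X n) (X n.+1) (X l); have := IH ln; lra.
Qed.

(** * Linear costs and purchases spread over a block of rounds *)

Section Instance.
Context {R : realType} {d : nat} (c w : 'rV[R]_d) (k : 'I_d) (L U : R).
Hypothesis c_gt0 : forall i, 0 < c 0 i.
Implicit Types (p : R) (x : 'rV[R]_d).

(** The factor [c 0 i] makes prices refer to one unit of utilization. *)
Definition price_cost p x : R :=
  \sum_i (if i == k then p else U) * c 0 i * x 0 i.

Lemma price_cost_function p : L <= p <= U -> cost_function c L U (price_cost p).
Proof.
move=> /andP[Lp pU]; have LU := le_trans Lp pU; split.
- move=> t x y _ _.
  have E : price_cost p (t%:num *: (x : 'rV[R]_d) + (1 - t%:num) *: (y : 'rV[R]_d)) =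
      t%:num * price_cost p x + (1 - t%:num) * price_cost p y.
    rewrite /price_cost !mulr_sumr -big_split /=; apply: eq_bigr => i _.
    by rewrite !mxE; ring.
  by rewrite le_eqVlt; apply/orP; left; apply/eqP; exact: E.
- by rewrite /price_cost big1// => i _; rewrite mxE mulr0.
- move=> x _; exists (\row_i ((if i == k then p else U) * c 0 i)); split.
    rewrite /is_gradient_within.
    have -> : (fun y : 'rV[R]_d => (price_cost p y - price_cost p x -
        \sum_i (\row_j ((if j == k then p else U) * c 0 j)) 0 i *
          (y 0 i - x 0 i)) / `|y - x|) = cst 0.
      apply/funext => y; rewrite /price_cost -!sumrB big1 ?mul0r// => i _.
      by rewrite mxE mulrBr subrr.
    exact: cvg_cst.
  move=> i; rewrite mxE mulfK; last by rewrite gt_eqF.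
  by case: (i == k); rewrite ?Lp ?pU ?LU ?lexx.
Qed.

Definition spike (e : R) : 'rV[R]_d := \row_i (if i == k then e / c 0 k else 0).

(** Serves both as the advice and as the offline solution that bounds [OPT]. *)
Definition block (lo hi : nat) (e : R) (t : nat) : 'rV[R]_d :=
  spike (e * (lo < t <= hi)%N%:R).

Lemma wl1norm_spike (u : 'rV[R]_d) e : 0 <= e ->
  wl1norm u (spike e) = u 0 k / c 0 k * e.
Proof.
move=> e0; rewrite /wl1norm (bigD1 k)//= big1 => [|i /negPf ik].
  by rewrite mxE eqxx ger0_norm ?divr_ge0// ?ltW// addr0 mulrA mulrAC.
by rewrite mxE ik normr0 mulr0.
Qed.

Lemma price_cost_spike p e : price_cost p (spike e) = p * e.
Proof.
rewrite /price_cost (bigD1 k)//= big1 => [|i /negPf ik].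
  by rewrite mxE eqxx addr0 -mulrA [c 0 k * _]mulrC divfK// gt_eqF.
by rewrite mxE ik mulr0.
Qed.

Lemma spikeB e f : spike e - spike f = spike (e - f).
Proof. by apply/rowP => i; rewrite !mxE; case: ifP; rewrite ?subrr// mulrBl. Qed.

Lemma wl1normN (u x : 'rV[R]_d) : wl1norm u (- x) = wl1norm u x.
Proof. by apply: eq_bigr => i _; rewrite mxE normrN. Qed.

Lemma sum_in_block lo hi T : (lo <= hi <= T)%N ->
  \sum_(1 <= t < T.+1) (lo < t <= hi)%N%:R = (hi - lo)%:R :> R.
Proof.
move=> lhT; rewrite -natr_sum; congr _%:R.
(* Truncating at [T] gives a form that survives induction on [T]. *)
have -> : (hi - lo = minn T hi - minn T lo)%N by lia.
elim: T {lhT} => [|T IH]; first by rewrite big_geq// !min0n.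
rewrite big_nat_recr//= IH; lia.
Qed.

Lemma sum_block_switch lo hi T : (lo < hi)%N ->
  \sum_(1 <= t < T.+1)
    `|(lo < t <= hi)%N%:R - (lo < t.-1 <= hi)%N%:R| <= 2 :> R.
Proof.
move=> lh.
have -> : \sum_(1 <= t < T.+1)
    `|(lo < t <= hi)%N%:R - (lo < t.-1 <= hi)%N%:R| =
    (lo < T)%N%:R + (hi < T)%N%:R :> R.
  elim: T => [|T IH]; first by rewrite big_geq// !ltn0 addr0.
  rewrite big_nat_recr//= {}IH !ltnS.
  have [?|?|?] := ltngtP lo T; have [?|?|?] := ltngtP hi T; try lia;
    rewrite /= ?subrr ?subr0 ?sub0r ?normrN ?normr1 ?normr0; lra.
by case: (lo < T)%N; case: (hi < T)%N => /=; lra.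
Qed.

Section Block.
Variables (lo hi T : nat).
Hypotheses (lohi : (lo < hi)%N) (hiT : (hi <= T)%N).
Let e : R := (hi - lo)%:R^-1.

Let e_ge0 : 0 <= e. Proof. by rewrite invr_ge0. Qed.

Let eB (t : nat) : 0 <= e * (lo < t <= hi)%N%:R.
Proof. by rewrite mulr_ge0. Qed.

Lemma block_feasible : e <= c 0 k -> feasible c T (block lo hi e).
Proof.
move=> ec; split=> [t _|].
  have ee t' : e * (lo < t' <= hi)%N%:R <= e.
    by case: (lo < t' <= hi)%N; rewrite ?mulr1 ?mulr0.
  split=> [i|].
    rewrite mxE; case: ifP => _; last by rewrite lexx ler01.
    apply/andP; split; first by rewrite divr_ge0// ltW.
    by rewrite ler_pdivrMr// mul1r (le_trans (ee _)).
  rewrite wl1norm_spike// divff ?gt_eqF// mul1r (le_trans (ee _))//.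
  by rewrite invf_le1 ?ltr0n ?subn_gt0// ler1n subn_gt0.
rewrite /utilization.
under eq_bigr do rewrite wl1norm_spike// divff ?gt_eqF// mul1r.
rewrite -mulr_sumr sum_in_block; last by rewrite (ltnW lohi).
by rewrite mulVf// pnatr_eq0 subn_eq0 -ltnNge.
Qed.

Lemma block_cost (f : nat -> 'rV[R]_d -> R) y : 0 <= w 0 k ->
  (forall t, (lo < t <= hi)%N -> f t = price_cost y) ->
  (forall t, (1 <= t <= T)%N -> f t 0 = 0) ->
  total_cost w T f (block lo hi e) <= y + 2 * (w 0 k / c 0 k) * e.
Proof.
move=> wk fy f0; rewrite /total_cost; apply: lerD.
  have -> : \sum_(1 <= t < T.+1) f t (block lo hi e t) =
      \sum_(1 <= t < T.+1) y * e * (lo < t <= hi)%N%:R.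
    apply: eq_big_nat => t tT; rewrite /block.
    have [tb|tb] := boolP (lo < t <= hi)%N.
      by rewrite fy// price_cost_spike !mulr1.
    rewrite !mulr0 (_ : spike 0 = 0) ?f0//.
    by apply/rowP => i; rewrite !mxE mul0r if_same.
  rewrite -mulr_sumr sum_in_block; last by rewrite (ltnW lohi).
  by rewrite -mulrA mulVf ?mulr1// pnatr_eq0 subn_eq0 -ltnNge.
have padE t : padded T (block lo hi e) t = block lo hi e t.
  rewrite /padded; case: ifP => // tT; rewrite /block.
  have -> : (lo < t <= hi)%N = false.
    by apply: contraFF tT => /andP[/(leq_ltn_trans (leq0n _)) -> /leq_trans ->].
  by apply/rowP => i; rewrite !mxE mulr0 mul0r if_same.
have -> : \sum_(1 <= t < T.+2)
     wl1norm w (padded T (block lo hi e) t - padded T (block lo hi e) t.-1) =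
   \sum_(1 <= t < T.+2) (w 0 k / c 0 k * e) *
     `|(lo < t <= hi)%N%:R - (lo < t.-1 <= hi)%N%:R|.
  apply: eq_bigr => t _; rewrite !padE /block spikeB -mulrBr.
  set D := _ - _; have [D0|D0] := leP 0 D.
    by rewrite wl1norm_spike ?mulr_ge0// mulrA ger0_norm.
  rewrite -wl1normN -[- spike _]add0r.
  have -> : 0 = spike 0 by apply/rowP => i; rewrite !mxE mul0r if_same.
  rewrite spikeB sub0r -mulrN wl1norm_spike ?mulrA ?ltr0_norm//.
  by rewrite mulr_ge0// oppr_ge0 ltW.
rewrite -mulr_sumr -[leRHS]mulrA [leRHS]mulrC.
apply: ler_wpM2l; last exact: sum_block_switch.
by rewrite mulr_ge0// divr_ge0// ltW.
Qed.

End Block.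
End Instance.

(** * Lower bounds on costs, and the offline optimum *)

Section Costs.
Context {R : realType} {d : nat} (c w : 'rV[R]_d) (k : 'I_d) (U : R).
Hypotheses (c_gt0 : forall i, 0 < c 0 i) (w_ge0 : forall i, 0 <= w 0 i).
Implicit Types (x s : 'rV[R]_d) (T : nat).

Lemma wl1norm_ge (u x : 'rV[R]_d) : (forall i, 0 <= u 0 i) ->
  u 0 k * `|x 0 k| <= wl1norm u x.
Proof.
move=> u0; rewrite /wl1norm (bigD1 k)//= lerDl sumr_ge0// => i _.
by rewrite mulr_ge0.
Qed.

Lemma price_cost_ge p V x : V <= U -> decision_set c x ->
  V * wl1norm c x + (p - V) * (c 0 k * `|x 0 k|) <= price_cost c k U p x.
Proof.
move=> VU [x01 _].
have x0 i : 0 <= x 0 i by case/andP: (x01 i).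
rewrite /wl1norm /price_cost (bigD1 k)//= [leRHS](bigD1 k)//= eqxx ger0_norm//.
have : V * (\sum_(i < d | i != k) c 0 i * `|x 0 i|) <=
    \sum_(i < d | i != k) (if i == k then p else U) * c 0 i * x 0 i.
  rewrite mulr_sumr; apply: ler_sum => i /negPf ->.
  by rewrite -mulrA ger0_norm// ler_wpM2r// mulr_ge0// ltW.
lra.
Qed.

(** Coordinates other than [k] pay at least [V] per unit, and their switching is dropped. After [P]
    the weight [price t - V] vanishes, and the remaining movement is at least the return to 0. *)
Lemma total_cost_ge (v : seq R -> R) (P : seq R) (V : R) (T : nat)
    (f : nat -> 'rV[R]_d -> R) (s : nat -> 'rV[R]_d) (price : nat -> R) :
  V <= U -> (size P <= T)%N ->
  (forall t, (1 <= t <= T)%N -> decision_set c (s t)) ->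
  (forall t, (1 <= t <= T)%N -> f t = price_cost c k U (price t)) ->
  (forall t, (size P < t <= T)%N -> price t = V) ->
  (forall Q p P', P = Q ++ p :: P' -> p = price (size P').+1) ->
  (forall Q P', P = Q ++ P' ->
    v P' = c 0 k * `|padded T s (size P') 0 k|) ->
  V * utilization c s T + excess_cost v (w 0 k / c 0 k) V P
    <= total_cost w T f s /\
  usage v P <= utilization c s T.
Proof.
move=> VU PT sX fE priceV pE vE.
pose X t := c 0 k * `|padded T s t 0 k|.
have Xs t : (1 <= t <= T)%N -> X t = c 0 k * `|s t 0 k|.
  by move=> tT; rewrite /X /padded tT.
have X0 t : 0 <= X t by rewrite mulr_ge0// ltW.
have PT1 : ((size P).+1 <= T.+1)%N by rewrite ltnS.
split; last first.
  rewrite (usage_sum _ X)// /utilization [leRHS](big_cat_nat (n := (size P).+1))//=.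
  rewrite -[leLHS]addr0; apply: lerD.
    apply: ler_sum_nat => t /andP[t1 tP].
    rewrite Xs; last by rewrite t1 (leq_trans _ PT).
    by apply: wl1norm_ge => i; exact: ltW.
  by apply: sumr_ge0 => t _; apply: sumr_ge0 => i _; rewrite mulr_ge0// ltW.
rewrite /excess_cost addrA /total_cost; apply: lerD.
  rewrite (weighted_usage_sum _ X price)// /utilization.
  have -> : \sum_(1 <= t < (size P).+1) (price t - V) * X t =
            \sum_(1 <= t < T.+1) (price t - V) * X t.
    rewrite [RHS](big_cat_nat (n := (size P).+1))//=.
    rewrite [in X in _ = _ + X]big_nat [X in _ = _ + X]big1 ?addr0//.
    by move=> t tP; rewrite priceV ?subrr ?mul0r.
  rewrite mulr_sumr -big_split/=; apply: ler_sum_nat => t tT.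
  by rewrite fE// Xs//; apply: price_cost_ge => //; exact: sX.
rewrite /round_trip (variation_sum _ X)// (vE [::] P)// -/(X (size P)).
have XT : X T.+1 = 0 by rewrite /X /padded ltnn mxE normr0 mulr0.
have : \sum_(1 <= t < (size P).+1) `|X t - X t.-1| + X (size P) <=
       \sum_(1 <= t < T.+2) `|X t - X t.-1|.
  rewrite [leRHS](big_cat_nat (n := (size P).+1))//=; last by rewrite ltnS leqW.
  rewrite lerD2l; apply: le_trans (ler_norm_telescope X _ _ (leqW PT)).
  by rewrite XT sub0r normrN ger0_norm.
have b0 : 0 <= w 0 k / c 0 k by rewrite divr_ge0// ltW.
move=> /(ler_wpM2l b0)/le_trans; apply.
rewrite mulr_sumr; apply: ler_sum => t _.
apply: le_trans (wl1norm_ge _ _ w_ge0); rewrite !mxE.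
rewrite /X -mulrBr normrM (ger0_norm (ltW (c_gt0 k))) mulrA divfK ?gt_eqF//.
by apply: ler_wpM2l => //; exact: ler_dist_dist.
Qed.

Lemma total_cost_ge0 (T : nat) (f : nat -> 'rV[R]_d -> R)
    (s : nat -> 'rV[R]_d) :
  (forall t, (1 <= t <= T)%N -> exists2 p, 0 <= p & f t = price_cost c k U p) ->
  0 <= U -> (forall t, (1 <= t <= T)%N -> decision_set c (s t)) ->
  0 <= total_cost w T f s.
Proof.
move=> fE U0 sX; apply: addr_ge0; last first.
  by apply: sumr_ge0 => t _; apply: sumr_ge0 => i _; rewrite mulr_ge0.
rewrite big_nat; apply: sumr_ge0 => t tT; have [p p0 ->] := fE t tT.
have [x01 _] := sX t tT; apply: sumr_ge0 => i _.
apply: mulr_ge0; last by case/andP: (x01 i).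
by apply: mulr_ge0; [case: ifP|rewrite ltW].
Qed.

(** Nonnegative costs bound the set below, so [inf] is a genuine infimum. *)
Lemma OPT_bounds (T : nat) (f : nat -> 'rV[R]_d -> R) (s : nat -> 'rV[R]_d) :
  (forall t, (1 <= t <= T)%N -> exists2 p, 0 <= p & f t = price_cost c k U p) ->
  0 <= U -> feasible c T s -> 0 <= OPT c w T f <= total_cost w T f s.
Proof.
move=> fE U0 sF; apply/andP; split.
  apply: lb_le_inf; first by exists (total_cost w T f s), s.
  by move=> _ [s' [s'X _] <-]; exact: total_cost_ge0.
apply: ge_inf; last by exists s.
by exists 0 => _ [s' [s'X _] <-]; exact: total_cost_ge0.
Qed.

End Costs.

(** * Playing the game against an online algorithm *)

Section Run.
Context {R : realType} {d : nat} (c w : 'rV[R]_d) (k : 'I_d) (L U : R).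
Hypotheses (c_gt0 : forall i, 0 < c 0 i) (w_ge0 : forall i, 0 <= w 0 i).
Context (A : @la_algorithm R d) (T m : nat).
Hypotheses (L_gt0 : 0 < L) (A_feasible : cfl_algorithm c L U A).
Hypotheses (m_gt0 : (0 < m)%N) (m_large : m%:R^-1 <= c 0 k).
Implicit Types (P Q : seq R) (V : R) (t : nat).
Local Notation b := (w 0 k / c 0 k).

(** The advice is silent throughout the history; [rev] restores chronological order, and the empty
    history stands for [x_0 = 0]. *)
Definition alg_usage P : R :=
  if P is [::] then 0
  else c 0 k * `|A T [seq (price_cost c k U p, 0) | p <- rev P] 0 k|.

(** The default of [nth] supplies the price [V] after [P]. *)
Definition prefix_costs V P t : 'rV[R]_d -> R :=
  price_cost c k U (nth V (rev P) t.-1).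

Definition late_advice P : nat -> 'rV[R]_d :=
  block c k (size P) T (T - size P)%:R^-1.

Lemma alg_usage_ge0 P : 0 <= alg_usage P.
Proof. by case: P => //= p P; rewrite mulr_ge0// ltW. Qed.

(** Online decisions within [P] see neither [V] nor the late advice, so one function [alg_usage]
    describes all continuations. *)
Lemma alg_usage_run V P Q P' : (size P <= T)%N -> P = Q ++ P' ->
  alg_usage P' =
  c 0 k * `|padded T (run A T (prefix_costs V P) (late_advice P)) (size P') 0 k|.
Proof.
move=> PT PE; case P'E : P' => [|p P''].
  by rewrite /padded/= mxE normr0 mulr0.
rewrite /alg_usage -P'E; have P'0 : (0 < size P')%N by rewrite P'E.
have P'P : (size P' <= size P)%N by rewrite PE size_cat leq_addl.
rewrite /padded P'0 (leq_trans P'P PT)/= /run; congr (_ * `|A T _ 0 k|).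
apply: (@eq_from_nth _ (price_cost c k U 0, 0)).
  by rewrite !size_map size_rev size_iota.
move=> i; rewrite size_map size_rev => iP'.
rewrite (nth_map 0) ?size_rev// (nth_map 0) ?size_iota// nth_iota// add1n.
congr pair.
  rewrite /prefix_costs PE rev_cat /= nth_cat size_rev iP'.
  by congr price_cost; apply: set_nth_default; rewrite size_rev.
rewrite /late_advice /block ltnNge (leq_trans iP' P'P)/= mulr0.
by apply/rowP => j; rewrite !mxE mul0r if_same.
Qed.

(** The advice spreads one unit over at least [m] rounds at price [V]. The two lower bounds use
    utilization at least 1 and at least the usage on [P]. *)
Lemma prefix_run V P : L <= V <= U -> all (fun p => L <= p <= U) P ->
  (size P + m <= T)%N ->
  let f := prefix_costs V P in let a := late_advice P in
  [/\ cfl_instance c L U T f, feasible c T a,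
      total_cost w T f a <= V + 2 * b / m%:R &
      (V + excess_cost alg_usage b V P <= total_cost w T f (run A T f a)) /\
      (V * usage alg_usage P + excess_cost alg_usage b V P
         <= total_cost w T f (run A T f a))].
Proof.
move=> /andP[LV VU] PLU PmT f a.
have PT : (size P <= T)%N by rewrite (leq_trans _ PmT)// leq_addr.
have PltT : (size P < T)%N by rewrite (leq_trans _ PmT)// -addn1 leq_add2l.
have mT : (m <= T - size P)%N by rewrite leq_subRL.
have eTm : (T - size P)%:R^-1 <= m%:R^-1 :> R.
  by rewrite lef_pV2 ?posrE ?ltr0n ?ler_nat// (leq_trans m_gt0).
have inst : cfl_instance c L U T f.
  move=> t _; apply: price_cost_function => //.
  have [tP|tP] := ltnP t.-1 (size (rev P)); last by rewrite nth_default// LV VU.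
  by move/allP: PLU; apply; rewrite -mem_rev mem_nth.
have af : feasible c T a.
  by apply: block_feasible => //; exact: le_trans m_large.
have [sX sU] := A_feasible T f a inst af.
split=> //.
  have /le_trans : total_cost w T f a <= V + 2 * b * (T - size P)%:R^-1.
    apply: block_cost => //.
      move=> t /andP[tP _]; rewrite /f /prefix_costs nth_default// size_rev.
      by case: t tP.
    move=> t _; rewrite /f /prefix_costs /price_cost big1// => i _.
    by rewrite mxE mulr0.
  apply; rewrite lerD2l ler_wpM2l// mulr_ge0// divr_ge0// ltW//.
have [||||lb us] := total_cost_ge c w k U c_gt0 w_ge0 alg_usage P V T f
  (run A T f a) (fun t => nth V (rev P) t.-1) VU PT sX.
- by [].
- by move=> t /andP[tP _]; rewrite nth_default// size_rev; case: t tP.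
- move=> Q p P' ->.
  by rewrite rev_cat rev_cons cat_rcons nth_cat size_rev ltnn subnn.
- by move=> Q P'; exact: alg_usage_run.
have V0 : 0 <= V by rewrite (le_trans (ltW L_gt0)).
split; apply: le_trans lb; rewrite lerD2r.
  by rewrite -[leLHS]mulr1 ler_wpM2l.
by rewrite ler_wpM2l.
Qed.

End Run.

(** * The lower bound on robustness *)

Lemma switch_ratioE {R : realType} {d : nat} (c w : 'rV[R]_d) : (0 < d)%N ->
  (forall i, 0 < c 0 i) -> (forall i, 0 <= w 0 i) ->
  exists k, switch_ratio c w = w 0 k / c 0 k.
Proof.
case: d c w => // d c w _ c0 w0; rewrite /switch_ratio.
rewrite (bigmax_eq_arg _ ord0)//; first by eexists.
by move=> i _; rewrite divr_ge0// ltW.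
Qed.

Theorem theorem4 (R : realType) (d : nat) (c w : 'rV[R]_d) (L U eps : R)
  (hd : (0 < d)%N)
  (hc : forall i, 0 < c 0 i)
  (hw : forall i, 0 <= w 0 i)
  (hL : 0 < L)
  (hLU : L < U)
  (hbeta : switch_ratio c w < (U - L) / 2)
  (heps : 0 < eps <= alpha L U (switch_ratio c w) - 1) :
  exists gamma : R,
    unique (gamma_solution L U (switch_ratio c w) eps) gamma /\
    forall A : la_algorithm,
      cfl_algorithm c L U A ->
      consistent c w L U A (1 + eps) ->
      forall r : R, robust c w L U A r -> gamma <= r.
Proof.
have [k bE] := switch_ratioE c w hd hc hw; rewrite bE in hbeta heps *.
move: heps => /andP[e0 _]; have b0 : 0 <= w 0 k / c 0 k by rewrite divr_ge0// ltW.
set b := w 0 k / c 0 k in b0 hbeta *.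
have LbU : L < U - 2 * b by lra.
have [gamma sol] := gamma_solution_exists L U b hL b0 LbU eps e0.
exists gamma; split.
  by split=> // g; exact: gamma_solution_unique.
move=> A Af Ac r Ar; rewrite leNgt; apply/negP => rg.
have [g0 /andP[LY YU] _] := (gamma_solutionE L U b hL b0 LbU eps gamma).1 sol.
have gap := robustness_gap L U b hL b0 LbU eps gamma r e0 sol rg.
(* From [m0] rounds on, a block of equal purchases respects the box constraint in coordinate [k]. *)
have [m0 hm0] := natr_mul_unbounded 1 (c 0 k) (hc k).
have mk m : (m0 <= m)%N -> (0 < m)%N -> m%:R^-1 <= c 0 k.
  move=> m0m m_gt0; rewrite -[leLHS]mul1r ler_pdivrMr ?ltr0n// mulrC.
  by rewrite (le_trans (ltW hm0))// ler_wpM2r ?ler_nat// ltW.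
have U0 : 0 <= U by lra.
have LLU : L <= L <= U by lra.
have ULU : L <= U <= U by lra.
have priceE T V P : 0 <= V -> all (fun p => L <= p <= U) P ->
    forall t, (1 <= t <= T)%N ->
    exists2 p, 0 <= p & prefix_costs c k U V P t = price_cost c k U p.
  move=> V0 /allP PLU t _; exists (nth V (rev P) t.-1) => //.
  have [tP|tP] := ltnP t.-1 (size (rev P)); last by rewrite nth_default.
  have /PLU : nth V (rev P) t.-1 \in P by rewrite -mem_rev mem_nth.
  by lra.
(* Constant price [L]: the cost is at least [L > 0], whereas a negative [r] would make [r * OPT] at
   most 0. *)
have r0 : 0 <= r.
  have [inst af _ [lb _]] := prefix_run c w k L U hc hw A m0.+1 m0.+1
    hL Af (ltn0Sn _) (mk m0.+1 (leqnSn _) (ltn0Sn _)) L [::]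
    LLU isT (leqnn _).
  have := Ar _ _ _ inst af => /(le_trans lb).
  have /andP[+ _] := OPT_bounds c w k U hc hw _ _ _
    (priceE m0.+1 L [::] (ltW hL) isT) U0 af.
  rewrite /excess_cost /round_trip /= !addr0 mulr0 addr0 => opt0 Lr.
  rewrite leNgt; apply/negP => rneg.
  have := mulr_le0_ge0 (ltW rneg) opt0; lra.
(* The usage cap: with continuation [L], consistency bounds [L] times the usage by
   [(1 + eps) * (L + 2 * b)]. *)
have B0 : 0 <= (1 + eps) * (L + 2 * b) / L.
  by rewrite divr_ge0 ?mulr_ge0//; lra.
have [m [T0 [m0m m_gt0 wins]]] := adversary_wins L U b _ eps r (U / gamma) m0
  b0 r0 (ltW e0) B0 LY YU gap.
have run := prefix_run c w k L U hc hw A (T0 + m) m hL Af m_gt0 (mk m m0m m_gt0).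
have m1 : 2 * b / m%:R <= 2 * b.
  by rewrite ler_pdivrMr ?ltr0n// ler_peMr ?ler1n//; lra.
apply: (wins (alg_usage c k U A (T0 + m))).
- exact: alg_usage_ge0.
- move=> P PT PLU.
  have [|inst af adv [_ lb]] := run L P LLU PLU; first by rewrite leq_add2r.
  have := le_trans lb (Ac _ _ _ inst af).
  have : 0 <= excess_cost (alg_usage c k U A (T0 + m)) b L P.
    apply: excess_cost_ge0 => //; first exact: alg_usage_ge0.
    by apply: sub_all PLU => p /andP[].
  have adv' : (1 + eps) * total_cost w (T0 + m) (prefix_costs c k U L P)
      (late_advice c k (T0 + m) P) <= (1 + eps) * (L + 2 * b).
    by apply: ler_wpM2l; [lra|rewrite (le_trans adv)// lerD2l].
  by rewrite -/b ler_pdivlMr// [_ * L]mulrC; lra.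
- move=> P PT PLU.
  have [|inst af adv [lb _]] := run L P LLU PLU; first by rewrite leq_add2r.
  apply: le_trans (le_trans lb (Ac _ _ _ inst af)) _.
  by apply: ler_wpM2l; [lra|exact: adv].
(* The game stops and continues with [U]; buying evenly during the [m] rounds at price [y] bounds
   [OPT]. *)
- move=> P y yLU PT PLU.
  have [|inst af adv [lb _]] := run U _ ULU PLU; first by rewrite leq_add2r.
  have lohi : (size P < size P + m)%N by rewrite -addn1 leq_add2l.
  have hiT : (size P + m <= T0 + m)%N.
    by rewrite leq_add2r (leq_trans _ PT)// size_cat leq_addl.
  have sE : (size P + m - size P)%N = m by rewrite addKn.
  have optf := block_feasible c k hc _ _ (T0 + m) lohi hiT.
  have optc := block_cost c w k U hc _ _ (T0 + m) lohi hiT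
    (prefix_costs c k U U (nseq m y ++ P)) y (hw k).
  rewrite sE in optf optc.
  have {}optf := optf (mk m m0m m_gt0).
  have {}optc : total_cost w (T0 + m) (prefix_costs c k U U (nseq m y ++ P))
      (block c k (size P) (size P + m) m%:R^-1) <= y + 2 * b / m%:R.
    apply: optc => t.
      move=> /andP[Pt tPm]; rewrite /prefix_costs; congr price_cost.
      rewrite rev_cat nth_cat size_rev ltnNge.
      have -> : (size P <= t.-1)%N by case: t Pt {tPm}.
      rewrite /= rev_nseq nth_nseq ifT//; case: t Pt tPm => //= t Pt tPm.
      by rewrite ltn_subLR.
    by move=> _; rewrite /prefix_costs /price_cost big1// => i _; rewrite mxE mulr0.
  have /andP[_ opt] := OPT_bounds c w k U hc hw _ _ _
    (priceE (T0 + m)%N U _ U0 PLU) U0 optf.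
  apply: le_trans (le_trans lb (Ar _ _ _ inst af)) _.
  by rewrite ler_wpM2l// (le_trans opt).
Qed.
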